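(* Let $\Psi:\mathbb{R}^n\to\mathbb{R}\cup\{\infty\}$ be proper, closed, and convex, let $\delta\geq 0$, let $B\in\mathbb{R}^{n\times n}$ be positive definite, and let $x,g,u\in\mathbb{R}^n$. The following are equivalent: (i) $u\in \mathrm{Prox}^B_\Psi(x,g,\delta)$. (ii) There exist $\delta'\in[0,\delta]$ and $v\in\mathbb{R}^n$ such that $\|v\|_B^*\leq\sqrt{2(\delta-\delta')}$ and $v-g-B(u-x)\in\partial_{\delta'}\Psi(u)$. (iii) There exist $\delta'\in[0,\delta]$ and $v\in\mathbb{R}^n$ such that $\|v\|_B^*\leq\sqrt{2(\delta-\delta')}$ and $$\langle v-g-B(u-x),\,y-u\rangle\leq \Psi(y)-\Psi(u)+\delta'\quad\text{for all }y\in\mathbb{R}^n.$$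
   Context: $\langle\cdot,\cdot\rangle$ is an inner product on $\mathbb{R}^n$. Positive definite means self-adjoint with respect to $\langle\cdot,\cdot\rangle$ with $\langle Bx,x\rangle>0$ for $x\neq 0$. $\|\cdot\|_B$ is the norm induced by the inner product $(x,y)\mapsto\langle Bx,y\rangle$, i.e. $\|x\|_B=\sqrt{\langle Bx,x\rangle}$, and $\|\cdot\|_B^*$ is its dual norm, which equals $\|\cdot\|_{B^{-1}}$. For $x,g\in\mathbb{R}^n$ and $\delta\geq 0$, the inexact pre-conditioned proximal map is the set $$\mathrm{Prox}^B_\Psi(x,g,\delta):=\Big\{y\in\mathbb{R}^n: \langle g,y\rangle+\tfrac12\|y-x\|_B^2+\Psi(y)\leq\min_{z\in\mathbb{R}^n}\big\{\langle g,z\rangle+\tfrac12\|z-x\|_B^2+\Psi(z)\big\}+\delta\Big\}.$$ For $\delta\ge 0$ and $x\in\mathrm{dom}(\Psi)=\{x:\Psi(x)<\infty\}$, $\partial_\delta\Psi(x)$ is the $\delta$-subdifferential: the set of all $s\in\mathbb{R}^n$ (the $\delta$-subgradients) such that $\Psi(y)\geq\Psi(x)+\langle s,y-x\rangle-\delta$ for all $y\in\mathbb{R}^n$; it is empty when $x\notin\mathrm{dom}(\Psi)$. The inequality in (iii) is understood to require $u\in\mathrm{dom}(\Psi)$. *)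

(* Defs.v *)
From HB Require Import structures.
From mathcomp Require Import all_boot all_order all_algebra sesquilinear.
From mathcomp Require Import all_classical all_reals all_analysis.

Set Implicit Arguments.
Unset Strict Implicit.
Unset Printing Implicit Defensive.

Import Order.TTheory GRing.Theory Num.Theory.
Import numFieldNormedType.Exports.

Local Open Scope classical_set_scope.
Local Open Scope ring_scope.

(* [R^n] is ['cV[R]_n], with its usual topology; a function with values in
   [R ∪ {+oo}] is a [Psi : 'cV[R]_n -> \bar R] that is [proper_fun] (this includes
   [Psi x != -oo]).  An inner product is a [{dot 'cV[R]_n for idfun}], i.e. an
   arbitrary symmetric positive definite bilinear form. *)

Section ExtendedRealFunctions.
Context {R : realType} {n : nat}.
Implicit Types Psi f : 'cV[R]_n -> \bar R.

Definition edom Psi : set 'cV[R]_n := [set x | (Psi x < +oo)%E].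

Definition proper_fun Psi : Prop := (forall x, Psi x != -oo%E) /\ edom Psi !=set0.

Definition epigraph Psi : set ('cV[R]_n * R) := [set p | (Psi p.1 <= p.2%:E)%E].

Definition closed_fun Psi : Prop := closed (epigraph Psi).

(* With [Psi] never equal to [-oo], no [+oo - oo] occurs on the right-hand
   side, and [0 * +oo = 0] makes the cases [t = 0] and [t = 1] trivial. *)
Definition convex_fun Psi : Prop :=
  forall (x y : 'cV[R]_n) (t : R), 0 <= t <= 1 ->
    (Psi (t *: x + (1 - t) *: y)%R <= t%:E * Psi x + (1 - t)%:E * Psi y)%E.

(* An attained minimum, not merely an infimum. *)
Definition is_min f (m : \bar R) : Prop :=
  (exists z, f z = m) /\ (forall z, (m <= f z)%E).

End ExtendedRealFunctions.

Section InnerProduct.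
Context {R : realType} {n : nat} (ip : {dot 'cV[R]_n for idfun}).
Implicit Types (B : 'M[R]_n) (x g u v s : 'cV[R]_n) (Psi : 'cV[R]_n -> \bar R).

Definition self_adjoint B : Prop := forall x y, ip (B *m x) y = ip x (B *m y).

Definition pos_def B : Prop :=
  self_adjoint B /\ forall x, x != 0 -> 0 < ip (B *m x) x.

Definition mxnorm B x : R := Num.sqrt (ip (B *m x) x).

(* The supremum is taken in [\bar R] so that it needs no boundedness side
   condition; it is finite when [N] is a norm. *)
Definition dual_norm (N : 'cV[R]_n -> R) v : \bar R :=
  ereal_sup [set (ip v x)%:E | x in [set x | N x <= 1]].

Definition prox_obj B Psi x g (y : 'cV[R]_n) : \bar R :=
  ((ip g y + 2^-1 * mxnorm B (y - x) ^+ 2)%:E + Psi y)%E.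

Definition prox B Psi x g (delta : R) : set 'cV[R]_n :=
  [set y | exists2 m, is_min (prox_obj B Psi x g) m &
                      (prox_obj B Psi x g y <= m + delta%:E)%E].

Definition subdifferential (delta : R) Psi x : set 'cV[R]_n :=
  [set s | edom Psi x /\
    forall y : 'cV[R]_n, (Psi x + (ip s (y - x))%:E - delta%:E <= Psi y)%E].

End InnerProduct.

(* Main.v *)
(** Let F(y) = <g,y> + 1/2 |y - x|_B^2 + Psi(y).  If p minimizes F, then
    s = - g - B(p - x) is a subgradient of Psi at p; taking v = B(u - p) in (ii)
    makes v - g - B(u - x) equal to s, and F(u) - F(p) splits as
    1/2 |u - p|_B^2 + delta', where delta' is the error with which s is a
    subgradient at u.  Conversely (iii) and Young's inequality
    <v,w> + 1/2 |w|_B^2 >= - 1/2 (|v|_B^* )^2 give F(u) <= F(y) + delta for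
    all y; the minimum is attained because F is bounded below, strongly convex
    and closed. *)
Require Import Defs.
From mathcomp Require Import all_boot all_order all_algebra sesquilinear.
From mathcomp Require Import all_classical all_reals all_analysis.
From mathcomp Require Import ring lra.

Set Implicit Arguments.
Unset Strict Implicit.
Unset Printing Implicit Defensive.

Import Order.TTheory GRing.Theory Num.Theory.
Import numFieldNormedType.Exports.

Local Open Scope classical_set_scope.
Local Open Scope ring_scope.

(** * The inner product [ip (B *m x) y] and its norm *)

Section EnergyNorm.
Context {R : realType} {n : nat} (ip : {dot 'cV[R]_n for idfun}).
Implicit Types (B : 'M[R]_n) (x y z v : 'cV[R]_n).

Lemma ipC x y : ip x y = ip y x.
Proof. by rewrite hermC expr0 mul1r. Qed.

Lemma ipZr v a x : ip v (a *: x) = a * ip v x.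
Proof. exact: linearZr_LR. Qed.

Lemma ip_sum_coord v x : ip v x = \sum_i x i ord0 * ip v (delta_mx i ord0).
Proof.
rewrite [in LHS](matrix_sum_delta x) linear_sumr; apply: eq_bigr => i _.
by rewrite big_ord1; exact: ipZr.
Qed.

Lemma ip_continuous v : continuous (fun x => ip v x).
Proof.
rewrite (_ : (fun x => _) =
  (fun x => \sum_i x i ord0 * ip v (delta_mx i ord0))); last first.
  by apply/funext => y; exact: ip_sum_coord.
apply: continuous_big => [|i _ x]; first exact: add_continuous.
apply: (continuousM (@coord_continuous _ _ _ i ord0 x)).
exact: cst_continuous.
Qed.

Context {B} (hB : pos_def ip B).

Lemma energyC x y : ip (B *m x) y = ip (B *m y) x.
Proof. by rewrite hB.1 ipC. Qed.

Lemma energy_ge0 x : 0 <= ip (B *m x) x.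
Proof.
have [->|x0] := eqVneq x 0; first by rewrite linear0r.
exact/ltW/hB.2.
Qed.

Lemma mxnorm_ge0 x : 0 <= mxnorm ip B x.
Proof. exact: sqrtr_ge0. Qed.

Lemma sqr_mxnorm x : mxnorm ip B x ^+ 2 = ip (B *m x) x.
Proof. exact/sqr_sqrtr/energy_ge0. Qed.

Lemma mxnorm_gt0 x : x != 0 -> 0 < mxnorm ip B x.
Proof. by move=> x0; rewrite sqrtr_gt0; exact: hB.2. Qed.

Lemma mxnorm0 : mxnorm ip B 0 = 0.
Proof. by rewrite /mxnorm linear0r sqrtr0. Qed.

Lemma sqr_mxnormD x y :
  mxnorm ip B (x + y) ^+ 2 =
  mxnorm ip B x ^+ 2 + 2 * ip (B *m x) y + mxnorm ip B y ^+ 2.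
Proof.
rewrite !sqr_mxnorm mulmxDr linearDl !linearDr /= (energyC y x).
by ring.
Qed.

Lemma energyZ a b x y :
  ip (B *m (a *: x)) (b *: y) = a * b * ip (B *m x) y.
Proof. by rewrite -scalemxAr linearZl_LR /= ipZr mulrA. Qed.

Lemma sqr_mxnormZ a x : mxnorm ip B (a *: x) ^+ 2 = a ^+ 2 * mxnorm ip B x ^+ 2.
Proof. by rewrite !sqr_mxnorm energyZ expr2. Qed.

Lemma mxnormZ a x : mxnorm ip B (a *: x) = `|a| * mxnorm ip B x.
Proof.
apply/(@pexpIrn _ 2); rewrite ?nnegrE ?mulr_ge0 ?mxnorm_ge0//.
by rewrite sqr_mxnormZ exprMn real_normK ?num_real.
Qed.

Lemma mxnormN x : mxnorm ip B (- x) = mxnorm ip B x.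
Proof. by rewrite /mxnorm mulmxN linearNl linearNr opprK. Qed.

(** With [a], [b] the norms of [x], [y] and [c] their [B]-product, the squared norm of
    [b *: x - a *: y] is [2ab(ab - c)]; it remains to divide by [ab]. *)
Lemma energy_CauchySchwarz x y : ip (B *m x) y <= mxnorm ip B x * mxnorm ip B y.
Proof.
have [->|y0] := eqVneq y 0; first by rewrite linear0r mxnorm0 mulr0.
have := mxnorm_gt0 y0; have := mxnorm_ge0 x.
have := sqr_ge0 (mxnorm ip B (mxnorm ip B y *: x - mxnorm ip B x *: y)).
rewrite -scaleNr sqr_mxnormD !sqr_mxnormZ energyZ.
set a := mxnorm ip B x; set b := mxnorm ip B y; set c := ip _ _.
move=> abc; rewrite le_eqVlt => /predU1P[a0 b0|a0 b0].
  have x0 : x = 0.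
    by apply/eqP/negPn/negP => /mxnorm_gt0; rewrite -/a -a0 ltxx.
  by rewrite -a0 mul0r /c x0 mulmx0 linear0l.
have ab0 : 0 < a * b by rewrite mulr_gt0.
by rewrite -(ler_pM2l ab0); lra.
Qed.

(** One half of the equivalence of norms: it turns Cauchy sequences for the [B]-norm into Cauchy
    sequences for the entrywise topology. *)
Lemma coord_le_mxnorm : exists2 C : R, 0 <= C &
  forall x i, `|x i ord0| <= C * mxnorm ip B x.
Proof.
pose G := \matrix_(i, j) ip (B *m delta_mx i ord0) (delta_mx j ord0) : 'M[R]_n.
have GE x y : ip (B *m x) y = (x^T *m G *m y) ord0 ord0.
  rewrite mxE ip_sum_coord; apply: eq_bigr => j _; rewrite mulrC; congr (_ * _).
  rewrite mxE energyC ip_sum_coord; apply: eq_bigr => i _.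
  by rewrite !mxE energyC.
(* A nonzero row [w] with [w G = 0] would give [w^T] zero energy. *)
have Gu : G \in unitmx.
  rewrite -row_free_unit -kermx_eq0; apply/negPn/negP => /rowV0Pn[w].
  move=> /sub_kermxP wG; rewrite -trmx_eq0 => /hB.2.
  by rewrite GE trmxK wG mul0mx mxE ltxx.
(* Coordinates are [B]-products with the columns of the inverse Gram matrix. *)
pose w i := invmx G *m delta_mx i ord0 : 'cV[R]_n.
have wE x i : x i ord0 = ip (B *m x) (w i).
  rewrite GE mulmxA mulmxK// mxE (bigD1 i)//= big1 => [|j ji].
    by rewrite !mxE !eqxx mulr1 addr0.
  by rewrite !mxE (negbTE ji) mulr0.
exists (\sum_i mxnorm ip B (w i)) => [|x i].
  by apply: sumr_ge0 => i _; exact: mxnorm_ge0.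
rewrite wE (@le_trans _ _ (mxnorm ip B x * mxnorm ip B (w i)))//.
  rewrite ler_norml energy_CauchySchwarz andbT lerNl -linearNr.
  by rewrite (le_trans (energy_CauchySchwarz _ _))// mxnormN.
rewrite mulrC ler_wpM2r ?mxnorm_ge0// (bigD1 i)//= lerDl.
by apply: sumr_ge0 => j _; exact: mxnorm_ge0.
Qed.

Lemma sqr_mxnorm_continuous : continuous (fun x => mxnorm ip B x ^+ 2).
Proof.
rewrite (_ : (fun x => _) =
  (fun x => \sum_i x i ord0 * ip (B *m delta_mx i ord0) x)); last first.
  apply/funext => y; rewrite sqr_mxnorm ip_sum_coord.
  by apply: eq_bigr => i _; rewrite energyC.
apply: continuous_big => [|i _ x]; first exact: add_continuous.
apply: (continuousM (@coord_continuous _ _ _ i ord0 x)).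
exact: ip_continuous.
Qed.

End EnergyNorm.

(** * The proximal objective: finite quadratic part, strong convexity, minimizer *)

Definition prox_quad {R : realType} {n : nat} (ip : {dot 'cV[R]_n for idfun})
    (B : 'M[R]_n) (x g y : 'cV[R]_n) : R :=
  ip g y + 2^-1 * mxnorm ip B (y - x) ^+ 2.

Section ProximalObjective.
Context {R : realType} {n : nat} (ip : {dot 'cV[R]_n for idfun}).
Context {B : 'M[R]_n} (hB : pos_def ip B).
Context {Psi : 'cV[R]_n -> \bar R} (hP : proper_fun Psi).
Context (x g : 'cV[R]_n).
Implicit Types (y z p u : 'cV[R]_n).

Local Notation quad := (prox_quad ip B x g).

Lemma prox_quad_taylor u y : quad y =
  quad u + ip (g + B *m (u - x)) (y - u) + 2^-1 * mxnorm ip B (y - u) ^+ 2.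
Proof.
suff quadD (d : 'cV[R]_n) : quad (u + d) =
    quad u + ip (g + B *m (u - x)) d + 2^-1 * mxnorm ip B d ^+ 2.
  by rewrite -quadD addrC subrK.
rewrite /prox_quad [u + d - x]addrAC (sqr_mxnormD hB (u - x)).
by rewrite linearDr [ip (g + _) _]linearDl /=; lra.
Qed.

(** Expand both endpoints around the intermediate point [w]: the first-order terms cancel and the
    quadratic ones combine into the last term. *)
Lemma prox_quad_segment (t : R) y z :
  quad (t *: y + (1 - t) *: z) = t * quad y + (1 - t) * quad z
    - 2^-1 * t * (1 - t) * mxnorm ip B (y - z) ^+ 2.
Proof.
set w := t *: y + _.
have yw : y - w = (1 - t) *: (y - z).
  by rewrite /w scalerBr opprD addrA [(1 - t) *: y]scalerBl scale1r.
have zw : z - w = - t *: (y - z).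
  rewrite /w scalerBl scale1r addrCA opprD addrA subrr add0r.
  by rewrite scaleNr scalerBr.
rewrite (prox_quad_taylor w y) (prox_quad_taylor w z) yw zw !sqr_mxnormZ//.
by rewrite !ipZr; ring.
Qed.

Lemma prox_quad_continuous : continuous quad.
Proof.
move=> y.
have subx : {for y, continuous (fun y => y - x)}.
  by apply: continuousB; [exact: cvg_id|exact: cst_continuous].
have nrm : {for y, continuous (fun y => mxnorm ip B (y - x) ^+ 2)}.
  apply: (continuous_comp (g := fun z => mxnorm ip B z ^+ 2) subx).
  exact: sqr_mxnorm_continuous.
apply: continuousD; first exact: ip_continuous.
by apply: continuousM => //; exact: cst_continuous.
Qed.

Lemma prox_obj_le y (a : R) :
  (prox_obj ip B Psi x g y <= a%:E)%E = (Psi y <= (a - quad y)%:E)%E.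
Proof. by rewrite /prox_obj -/(quad y) addeC EFinB leeBrDr. Qed.

(** Real upper bounds [a], [b] replace the values of the objective, so that the arithmetic stays in
    [R]. *)
Lemma prox_obj_convex (t a b : R) y z : convex_fun Psi -> 0 <= t <= 1 ->
  (prox_obj ip B Psi x g y <= a%:E)%E -> (prox_obj ip B Psi x g z <= b%:E)%E ->
  (prox_obj ip B Psi x g (t *: y + (1 - t) *: z) <=
    (t * a + (1 - t) * b
      - 2^-1 * t * (1 - t) * mxnorm ip B (y - z) ^+ 2)%:E)%E.
Proof.
move=> cvP t01; rewrite !prox_obj_le => ya zb.
have /andP[t0 t1] := t01.
rewrite (le_trans (cvP _ _ _ t01))//.
rewrite (@le_trans _ _ (t%:E * (a - quad y)%:E +
                        (1 - t)%:E * (b - quad z)%:E)%E)//.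
  by rewrite leeD// lee_wpmul2l// lee_fin ?subr_ge0.
by rewrite -!EFinM -EFinD lee_fin prox_quad_segment; lra.
Qed.

Lemma prox_obj_neqNy y : prox_obj ip B Psi x g y != -oo%E.
Proof. by have := hP.1 y; rewrite /prox_obj; case: (Psi y). Qed.

Lemma prox_obj_fin_witness : exists y (r : R), prox_obj ip B Psi x g y = r%:E.
Proof.
have [y] := hP.2; have := hP.1 y; rewrite /edom /= => Py Py'.
exists y, (quad y + fine (Psi y)).
by rewrite EFinD fineK// fin_numE Py lt_eqF.
Qed.

(* By strong convexity, a minimizing sequence is Cauchy for the [B]-norm. *)
Lemma prox_obj_has_min (c : R) : closed_fun Psi -> convex_fun Psi ->
  (forall y, (c%:E <= prox_obj ip B Psi x g y)%E) ->
  exists m, is_min (prox_obj ip B Psi x g) m.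
Proof.
move=> clP cvP cF; set F := prox_obj ip B Psi x g in cF *.
(* Only finite values are collected, so that the infimum is taken in [R]; the value [+oo] lies above
   it anyway. *)
pose S := [set r : R | exists y, F y = r%:E].
have S_inf : has_inf S.
  split; first by have [y [r yr]] := prox_obj_fin_witness; exists r, y.
  by exists c => r [y yr]; rewrite -lee_fin -yr.
pose m := inf S.
have mF y : (m%:E <= F y)%E.
  have := prox_obj_neqNy y; rewrite -/F; case Fy: (F y) => [r| |]//= _.
    by rewrite lee_fin; apply: ge_inf; [exact: S_inf.2|exists y].
  by rewrite leey.
have /choice[s sm] k : exists y, (F y <= (m + k.+1%:R^-1)%:E)%E.
  have k0 : 0 < k.+1%:R^-1 :> R by rewrite invr_gt0 ltr0n.
  have [r [y yr] rm] := inf_adherent k0 S_inf.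
  by exists y; rewrite yr lee_fin ltW.
(* At the midpoint the strong convexity term is 1/8 of the squared distance, and it is at most the
   mean of the two errors. *)
have s_dist k l : mxnorm ip B (s k - s l) ^+ 2 <= 4 * (k.+1%:R^-1 + l.+1%:R^-1).
  have h01 : 0 <= (2^-1 : R) <= 1 by lra.
  have := le_trans (mF _) (prox_obj_convex cvP h01 (sm k) (sm l)).
  rewrite lee_fin; move: k.+1%:R^-1 l.+1%:R^-1 (mxnorm _ _ _ ^+ 2) => a b q.
  by lra.
have [C C0 coordC] := coord_le_mxnorm hB.
have /cauchy_cvgP/cvg_ex[/= p s_cvg] : cauchy (s @ \oo).
  apply: cauchy_exP => e e0.
  have C1 : 0 < C ^+ 2 + 1 by rewrite ltr_wpDl ?sqr_ge0.
  (* Errors below [eta] give [d ^+ 2 <= 8 * eta], hence [(C * d) ^+ 2 < e ^+ 2]; the [+ 1] covers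
     [C = 0]. *)
  pose eta := e ^+ 2 / (8 * (C ^+ 2 + 1)).
  have eta0 : 0 < eta by rewrite divr_gt0 ?mulr_gt0 ?exprn_gt0.
  have [N _ sN] := near_infty_natSinv_lt (PosNum eta0).
  exists (s N), N => // k Nk; split=> // i j; rewrite ord1 /ball /=.
  rewrite -(@ltr_pXn2r _ 2) ?nnegrE ?(ltW e0)//.
  have := coordC (s N - s k) i; rewrite !mxE => sNk.
  have := s_dist N k; have /= := sN _ (leqnn N); have /= := sN _ Nk.
  move: (mxnorm_ge0 ip (B := B) (s N - s k)) sNk; set d := mxnorm _ _ _.
  move=> d0 sNk.
  move: k.+1%:R^-1 N.+1%:R^-1 => a b a_eta b_eta dab.
  have d_eta : d ^+ 2 <= 8 * eta by move: eta {eta0 sN} a_eta b_eta => r; lra.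
  rewrite (@le_lt_trans _ _ ((C * d) ^+ 2))//.
    by rewrite ler_pXn2r ?nnegrE ?mulr_ge0.
  rewrite exprMn (@le_lt_trans _ _ (C ^+ 2 * (8 * eta)))//.
    by rewrite ler_wpM2l ?sqr_ge0.
  have -> : e ^+ 2 = (C ^+ 2 + 1) * (8 * eta).
    by rewrite /eta; field; rewrite gt_eqF.
  by move: eta eta0 {sN a_eta b_eta d_eta} => r; lra.
have Fp : (F p <= m%:E)%E.
  rewrite /F prox_obj_le.
  (* Lower semicontinuity through the closed epigraph: the points [h k] lie in it and converge to
     [(p, m - quad p)]. *)
  pose h k := (s k, m + k.+1%:R^-1 - quad (s k)).
  suff : epigraph Psi (p, m - quad p) by [].
  apply: (closed_cvg (epigraph Psi) clP (F := \oo) (u_ := h)).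
    by apply: nearW => k; rewrite /epigraph /h /= -prox_obj_le.
  have cvg_height : (m + k.+1%:R^-1 - quad (s k)) @[k --> \oo] --> m - quad p.
    apply: cvgB; last exact: (cvg_comp _ _ s_cvg (@prox_quad_continuous p)).
    rewrite -[X in _ --> X]addr0; apply: cvgD; first exact: cvg_cst.
    exact: cvg_harmonic.
  exact: (cvg_pair s_cvg cvg_height).
exists m%:E; split=> //; by exists p; apply/le_anti; rewrite Fp mF.
Qed.

(* Expanding the quadratic term around [p], this growth is the optimality
   condition [- g - B (p - x) \in \partial Psi(p)]; it is the limit [t -> 0] of
   the strong convexity inequality between [y] and [p]. *)
Lemma prox_obj_growth (m : R) p y (a : R) : convex_fun Psi ->
  (forall z, (m%:E <= prox_obj ip B Psi x g z)%E) ->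
  (prox_obj ip B Psi x g p <= m%:E)%E -> (prox_obj ip B Psi x g y <= a%:E)%E ->
  m + 2^-1 * mxnorm ip B (y - p) ^+ 2 <= a.
Proof.
move=> cvP mF Fp Fy; set Q := 2^-1 * _.
have tQ (t : R) : 0 < t <= 1 -> (1 - t) * Q <= a - m.
  move=> /andP[t0 t1].
  have t01 : 0 <= t <= 1 by rewrite ltW.
  have := le_trans (mF _) (prox_obj_convex cvP t01 Fy Fp).
  by rewrite lee_fin => h; rewrite -(ler_pM2l t0) /Q; lra.
rewrite -lerBrDl leNgt; apply/negP => aQ.
have a0 : 0 <= a - m.
  by have := tQ 1; rewrite subrr mul0r; apply; rewrite ltr01 lexx.
have Q0 : 0 < Q by exact: le_lt_trans aQ.
have Q20 : 0 < 2 * Q by rewrite mulr_gt0.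
(* An explicit small [t] replaces the limit: it makes the left side the midpoint of [Q] and [a - m],
   which exceeds [a - m] by [aQ]. *)
have : (1 - (Q - (a - m)) / (2 * Q)) * Q <= a - m.
  by apply: tQ; rewrite divr_gt0 ?subr_gt0//= ler_pdivrMr// mul1r; lra.
have -> : (1 - (Q - (a - m)) / (2 * Q)) * Q = (Q + (a - m)) / 2.
  by field; rewrite gt_eqF.
by lra.
Qed.

End ProximalObjective.

(** * The dual norm and the pairing *)

Section DualNorm.
Context {R : realType} {n : nat} (ip : {dot 'cV[R]_n for idfun}).
Context {B : 'M[R]_n} (hB : pos_def ip B).

Lemma dual_norm_mulmx_le (d : 'cV[R]_n) :
  (dual_norm ip (mxnorm ip B) (B *m d) <= (mxnorm ip B d)%:E)%E.
Proof.
apply: ge_ereal_sup => _ [z /= z1 <-]; rewrite lee_fin.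
rewrite (le_trans (energy_CauchySchwarz hB _ _))//.
by rewrite ler_piMr// mxnorm_ge0.
Qed.

(** Rescale [z] to the unit sphere of the [B]-norm, where the supremum applies. *)
Lemma ip_le_dual_norm (v z : 'cV[R]_n) (r : R) :
  (dual_norm ip (mxnorm ip B) v <= r%:E)%E -> ip v z <= r * mxnorm ip B z.
Proof.
move=> vr; have [->|z0] := eqVneq z 0; first by rewrite linear0r mxnorm0 mulr0.
have nz := mxnorm_gt0 hB z0.
rewrite -ler_pdivrMr// mulrC -ipZr -lee_fin; apply: le_trans vr.
apply: ereal_sup_ubound; exists ((mxnorm ip B z)^-1 *: z) => //=.
by rewrite mxnormZ// gtr0_norm ?invr_gt0// mulVf// gt_eqF.
Qed.

End DualNorm.

Theorem theorem2p2 (R : realType) (n : nat) (ip : {dot 'cV[R]_n for idfun})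
    (Psi : 'cV[R]_n -> \bar R) (delta : R) (B : 'M[R]_n) (x g u : 'cV[R]_n) :
  proper_fun Psi -> closed_fun Psi -> convex_fun Psi ->
  0 <= delta -> pos_def ip B ->
  [<-> (* (i) *)
       prox ip B Psi x g delta u;
       (* (ii) *)
       exists (delta' : R) (v : 'cV[R]_n),
         [/\ 0 <= delta' <= delta,
             (dual_norm ip (mxnorm ip B) v
                <= (Num.sqrt (2 * (delta - delta')))%:E)%E
           & subdifferential ip delta' Psi u (v - g - B *m (u - x))];
       (* (iii) *)
       exists (delta' : R) (v : 'cV[R]_n),
         [/\ 0 <= delta' <= delta,
             (dual_norm ip (mxnorm ip B) v
                <= (Num.sqrt (2 * (delta - delta')))%:E)%E,
             edom Psi u
           & forall y : 'cV[R]_n,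
               ((ip (v - g - B *m (u - x)) (y - u))%:E
                 <= Psi y - Psi u + delta'%:E)%E] ].
Proof.
move=> hP clP cvP delta0 hB; set q := prox_quad ip B x g.
have fin_of_dom : edom Psi u -> exists U, Psi u = U%:E.
  by move: (hP.1 u); rewrite /edom /=; case: (Psi u) => // U; exists U.
have ipE v w : ip (v - g - B *m (u - x)) w = ip v w - ip (g + B *m (u - x)) w.
  by rewrite -addrA -opprD linearBl.
tfae.
- case=> M [[p <-{M}] minp] up.
  have [y0 [r0 Fy0]] := prox_obj_fin_witness ip (B := B) hP x g.
  have [m Fp] : exists m : R, prox_obj ip B Psi x g p = m%:E.
    have := prox_obj_neqNy ip (B := B) hP x g p; have := minp y0; rewrite Fy0.
    by case: (prox_obj _ _ _ _ _ p) => // r; exists r.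
  rewrite Fp -EFinD in up minp.
  have Fp' : (prox_obj ip B Psi x g p <= m%:E)%E by rewrite Fp.
  have growth y a := prox_obj_growth hB (y := y) (a := a) cvP minp Fp'.
  have Pu : edom Psi u.
    by rewrite prox_obj_le in up; exact: le_lt_trans up (ltry _).
  have [U PuE] := fin_of_dom Pu.
  have Uup : q u + U <= m + delta.
    by rewrite -lee_fin EFinD -PuE.
  have growU : m + 2^-1 * mxnorm ip B (u - p) ^+ 2 <= q u + U.
    by apply: growth; rewrite prox_obj_le PuE lee_fin -/(q u); lra.
  set d := u - p in growU.
  (* The gap [q u + U - m] is at most [delta], so [delta - delta'] is at least half the square of
     the norm of [d]; [growU] gives [0 <= delta']. *)
  pose delta' := q u + U - m - 2^-1 * mxnorm ip B d ^+ 2.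
  exists delta', (B *m d); split.
  + have := sqr_ge0 (mxnorm ip B d); rewrite /delta' => ?; lra.
  + apply: (le_trans (dual_norm_mulmx_le hB d)).
    rewrite lee_fin -[leLHS]ger0_norm ?mxnorm_ge0// -sqrtr_sqr ler_wsqrtr//.
    by rewrite /delta'; lra.
  + split=> // y; rewrite PuE.
    have := hP.1 y; case PyE: (Psi y) => [Y| |]// _; last by rewrite leey.
    have : m + 2^-1 * mxnorm ip B (y - p) ^+ 2 <= q y + Y.
      by apply: growth; rewrite prox_obj_le PyE lee_fin -/(q y); lra.
    (* In this form the cross term of the square is [<v, y - u>], and the squared norms of [y - u]
       on both sides cancel. *)
    have -> : y - p = d + (y - u) by rewrite /d [RHS]addrC addrA subrK.
    rewrite sqr_mxnormD// /q (prox_quad_taylor hB x g u y) -/(q _).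
    rewrite -!EFinD lee_fin ipE /delta'.
    by lra.
- case=> delta' [v [dd vd [Pu subu]]]; exists delta', v; split=> // y.
  have [U PuE] := fin_of_dom Pu; have := subu y; rewrite PuE.
  have := hP.1 y; case: (Psi y) => [Y| |]// _.
    by rewrite -!(EFinB, EFinD) !lee_fin; lra.
  by move=> _; rewrite -EFinN !addye// leey.
- case=> delta' [v [/andP[d0 dd] vd Pu subu]].
  have [U PuE] := fin_of_dom Pu.
  (* The left side is the objective at [u] minus [delta]: this one bound gives both the existence of
     a minimum and the near-optimality of [u]. *)
  have low y : ((q u + U - delta)%:E <= prox_obj ip B Psi x g y)%E.
    rewrite /prox_obj -/(prox_quad ip B x g y).
    have := subu y; have := hP.1 y; rewrite PuE.
    case: (Psi y) => [Y| |]// _; last by move=> _; rewrite addey// leey.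
    rewrite -!(EFinB, EFinD) !lee_fin (prox_quad_taylor hB x g u y) -/(q u) ipE.
    have := ip_le_dual_norm hB (- (y - u)) vd.
    rewrite mxnormN linearNr /=.
    (* Young's inequality; half the square of the root is [delta - delta'], which adds up with
       [delta'] to [delta]. *)
    have := sqr_ge0 (Num.sqrt (2 * (delta - delta')) - mxnorm ip B (y - u)).
    rewrite sqrrB sqr_sqrtr; last by lra.
    by lra.
  have [m mmin] := prox_obj_has_min hB hP clP cvP low.
  exists m => //; have [p Fp] := mmin.1.
  rewrite /prox_obj -/(prox_quad ip B x g u) -/(q u) PuE -EFinD.
  by rewrite -leeBlDr// -EFinB -Fp.
Qed.
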